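(* Let $S$ be a separable metric space. Then any tight sequence $(\mu_n)_{n\in\mathbf{N}}$ of probability measures on $S$ has a weakly convergent subsequence; that is, there exist $n_1<n_2<\cdots$ in $\mathbf{N}$ and a probability measure $\mu$ on $S$ such that $\mu_{n_k}$ converges weakly to $\mu$ as $k\to\infty$.
   Context: $\mathbf{N}=\{1,2,\ldots\}$. Probability measures on a metric space are defined on its Borel $\sigma$-field. A sequence $(\mu_n)_{n\in\mathbf{N}}$ of probability measures on a metric space $S$ is called tight if for each $\epsilon>0$ there is a compact $K\subset S$ such that $\mu_n(K)\ge 1-\epsilon$ for all $n\in\mathbf{N}$. Weak convergence of $\mu_{n_k}$ to $\mu$ means $\int f\,d\mu_{n_k}\to\int f\,d\mu$ for every bounded continuous $f\colon S\to\mathbf{R}$. *)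

(* Defs.v *)
From HB Require Import structures.
From mathcomp Require Import all_boot all_order all_algebra.
From mathcomp Require Import all_classical all_reals all_analysis.

Set Implicit Arguments.
Unset Strict Implicit.
Unset Printing Implicit Defensive.

Import Order.TTheory GRing.Theory Num.Theory.
Import numFieldNormedType.Exports.

Local Open Scope classical_set_scope.
Local Open Scope ring_scope.

(* [measurableType] requires a point, [metricType] does not provide one. Only
   the empty space is excluded, and it carries no probability measure. *)
#[short(type="pmetricType")]
HB.structure Definition PointedMetric (K : numDomainType) :=
  {M of Pointed M & Metric K M}.

Notation borel T := (g_sigma_algebraType (@open T)).

Definition separable (T : topologicalType) : Prop :=
  exists2 D : set T, countable D & dense D.

Section borel_probability_measures.
Context {R : realType} {S : pmetricType R}.
Implicit Types mu : nat -> probability (borel S) R.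

Definition tight mu : Prop :=
  forall eps : R, 0 < eps ->
    exists2 K : set S, compact K & forall n, ((1 - eps)%:E <= mu n K)%E.

Definition weak_cvg mu (nu : probability (borel S) R) : Prop :=
  forall f : S -> R, continuous f -> bounded_fun f ->
    (\int[mu n]_x (f x)%:E)%E @[n --> \oo] --> (\int[nu]_x (f x)%:E)%E.

End borel_probability_measures.

(* Main.v *)
Require Import Defs.
From HB Require Import structures.
From mathcomp Require Import all_boot all_order all_algebra.
From mathcomp Require Import all_classical all_reals all_analysis.
From mathcomp Require Import measurable_realfun lra.

(** The limit law is built as the law of a random point, in the manner of
Skorokhod's representation theorem; no outer measure and no representation of
positive functionals is involved.

Interleave a countable base of [S] with compact sets [K j] that carry mass
at least [1 - 1/(j+1)] under every [mu n], and call the resulting sequence of sets [B].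
Recording to which of [B 0], ..., [B (n-1)] a point belongs gives a binary word
of length [n], and so [S] is cut into at most [2^n] cells, which shrink as [n]
grows: by compactness, the cells of long words that lie in a fixed [K j] are
small with respect to any given open cover ([compact_small_cells]).

There are countably many words, hence a diagonal argument gives a subsequence
along which the mass of every cell converges, to [p w] for the word [w]
([diagonal_extraction]). The numbers [p w] need not be the masses of the cells
under the limit law, because mass can move to the boundary of a cell. But they
are additive along the binary tree of words, so nested intervals of length
[p w] code the words in the unit interval: a uniform random number [x] has a
random word of every length [n], and this word is [w] with probability [p w]
([uniform01_cell]). A word so drawn has [p w > 0], hence a nonempty cell, from
which a point is chosen. Tightness says that almost every [x] ends up in cells
inside a single [K j]; there the chosen points converge by compactness
([sample_cvg]), and the law of their limit is the measure looked for
([limit_measure_exists]).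

Weak convergence is now a finite computation. Given [f] bounded and continuous
and a small [e], choose [j] and then [n] such that [f] oscillates by at most [e]
on the cells of words of length [n] inside [K j]. Up to [e] and the small mass
outside [K j], the integral of [f] against [mu n] and the integral against the
limit law are both finite sums over the words of length [n], with weights the
masses of the cells in one case and [p w] in the other
([Rintegral_approx_cells], [limit_measure_exists]). These weights converge along
the subsequence ([weak_cvg_cell_masses]). *)

Set Implicit Arguments.
Unset Strict Implicit.
Unset Printing Implicit Defensive.

Import Order.TTheory GRing.Theory Num.Theory.
Import numFieldNormedType.Exports.

(** * Diagonal extraction *)

Section diagonal_extraction.
Local Open Scope classical_set_scope.
Local Open Scope ring_scope.
Context {R : realType}.

(** A non-principal ultrafilter gives limits to all bounded sequences at once;
this replaces the successive extractions of subsequences. *)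
Lemma ultrafilter_limits (I : Type) (u : I -> nat -> R) :
    (forall i n, 0 <= u i n <= 1) ->
  exists (F : set_system nat) (l : I -> R),
    [/\ ProperFilter F, \oo `<=` F & forall i, u i n @[n --> F] --> l i].
Proof.
move=> u01.
have [F [FU ooF]] := ultraFilterLemma (eventually_filter).
have lim_u i : exists l : R, u i n @[n --> F] --> l.
  have [l [_ cl]] : `[0, 1]%classic `&` cluster (u i n @[n --> F]) !=set0.
    apply: (@segment_compact R 0 1).
    by apply: (@filterE _ F) => n /=; rewrite in_itv; exact: u01.
  exists l => V Vl; have [//|FV] := in_ultra_setVsetC (u i @^-1` V) FU.
  by have [x []] := cl (~` V) V FV Vl.
have [l ul] := choice lim_u.
by exists F, l; split => //; exact: ultra_proper.
Qed.

(** Sets of an ultrafilter that contains the cofinite filter are infinite. Hence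
[phi k] can be chosen beyond [phi k.-1] and such that the first [k] sequences
are all within [1/(k+1)] of their ultrafilter limits. *)
Lemma diagonal_extraction (I : countType) (u : I -> nat -> R) :
    (forall i n, 0 <= u i n <= 1) ->
  exists (phi : nat -> nat) (l : I -> R),
    (forall i j : nat, (i < j)%N -> (phi i < phi j)%N) /\
    forall i, u i (phi k) @[k --> \oo] --> l i.
Proof.
move=> /ultrafilter_limits[F [l [PF ooF ul]]].
(* In the pair [kN], [kN.1] is the step and [kN.2] the previous index. *)
have next (kN : nat * nat) : exists n, (kN.2 < n)%N /\
    forall i, (pickle i < kN.1)%N -> `|l i - u i n| < kN.1.+1%:R^-1.
  case: kN => k N /=.
  have FN : F [set n | (N < n)%N] by apply: ooF; exact: nbhs_infty_gt.
  have Fk : F [set n | forall j : 'I_k, forall i : I, pickle i = j ->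
      `|l i - u i n| < k.+1%:R^-1].
    apply: (@filter_forall _ _ _ F) => j.
    have [[i ij]|noi] := pselect (exists i : I, pickle i = j).
      have /cvgrPdist_lt/(_ k.+1%:R^-1) := ul i.
      rewrite invr_gt0 ltr0n => /(_ isT); apply: filterS => n uin i' i'j.
      by have -> : i' = i by apply: (pcan_inj (@pickleK I)); rewrite ij.
    by apply: filterE => n i ij; exfalso; apply: noi; exists i.
  have [n [Nn kn]] := filter_ex (filterI FN Fk).
  by exists n; split => // i ik; exact: (kn (Ordinal ik)).
have [g gP] := choice next.
pose phi := fix phi k := if k is k'.+1 then g (k, phi k') else 0%N.
exists phi, l; split.
  by apply/(homo_ltn ltn_trans) => k /=; have [] := gP (k.+1, phi k).
move=> i; apply/cvgrPdist_lt => e e0.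
near=> k.
have k0 : (0 < k)%N by near: k; exact: nbhs_infty_gt.
rewrite -(prednK k0) /=; have [_ /(_ i)] := gP (k.-1.+1, phi k.-1).
rewrite /= prednK// => /(_ _)/lt_trans; apply.
  by near: k; exact: nbhs_infty_gt.
by near: k; exact: near_infty_natSinv_lt (PosNum e0).
Unshelve. all: by end_near. Qed.

End diagonal_extraction.

(** * Itineraries and their cells *)

Section itineraries.
Local Open Scope classical_set_scope.
Context {T : Type}.
Implicit Types (d : T -> seq bool -> bool) (w : seq bool) (x : T).

(** The next bit of a point may depend on the bits already read, so that one
notion covers both the coding of [S] by membership in a sequence of sets and the
coding of the unit interval by nested intervals. The newest bit comes first:
extending a word is a [cons]. *)
Fixpoint itinerary d n x : seq bool :=
  if n is n'.+1 then d x (itinerary d n' x) :: itinerary d n' x else [::].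

Definition cell d w : set T := [set x | itinerary d (size w) x = w].

Lemma size_itinerary d n x : size (itinerary d n x) = n.
Proof. by elim: n => //= n ->. Qed.

Lemma itinerary_cell d n x : cell d (itinerary d n x) x.
Proof. by rewrite /cell/= size_itinerary. Qed.

Lemma cell_nil d : cell d [::] = setT.
Proof. by apply/seteqP. Qed.

Lemma cell_cons d b w : cell d (b :: w) = cell d w `&` [set x | d x w = b].
Proof.
apply/seteqP; split => x; rewrite /cell/=; last by case=> -> ->.
by case=> <- iw; rewrite iw.
Qed.

(** Words of a given length form a finite type in this form, as finite sums over
them require. *)
Definition itinerary_tuple d n x : n.-tuple bool :=
  Tuple (introT eqP (size_itinerary d n x)).

Lemma preimage_itinerary_tuple d n (w : n.-tuple bool) :
  itinerary_tuple d n @^-1` [set w] = cell d w.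
Proof.
apply/seteqP; split => x; rewrite /cell/= size_tuple; first by move=> <-.
by move=> xw; exact: val_inj.
Qed.

Definition membership_code (B : nat -> set T) x w := x \in B (size w).

(** All points of a cell have the same bit at position [n]. *)
Lemma cell_membership_sub B w n x : (n < size w)%N ->
  cell (membership_code B) w x -> B n x -> cell (membership_code B) w `<=` B n.
Proof.
elim: w => // b w IHw; rewrite cell_cons/= ltnS leq_eqVlt.
move=> /predU1P[->|nw] [xw xb] Bx y [yw yb]; last exact: IHw Bx _ yw.
by apply/set_mem; change (membership_code B y w); rewrite yb -xb; exact/mem_set.
Qed.

End itineraries.

(** The shorter of two words read from [x] is a suffix of the longer one. The
point [x] lives in another space than the cells: the words are drawn in the unit
interval and then interpreted in [S]. *)
Lemma cell_itinerary_sub {T U : Type} (c : T -> seq bool -> bool)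
    (d : U -> seq bool -> bool) x m n : (m <= n)%N ->
  (cell c (itinerary d n x) `<=` cell c (itinerary d m x))%classic.
Proof.
elim: n => [|n IHn]; first by rewrite leqn0 => /eqP ->.
rewrite leq_eqVlt => /predU1P[->//|mn] y.
by rewrite [itinerary d n.+1 x]/= cell_cons => -[+ _]; exact: IHn.
Qed.

Section measurable_itineraries.
Local Open Scope classical_set_scope.
Context d {T : measurableType d}.

Lemma measurable_cell (c : T -> seq bool -> bool) w :
  (forall v, measurable [set x | c x v]) -> measurable (cell c w).
Proof.
move=> mc; elim: w => [|b w mw]; first by rewrite cell_nil.
rewrite cell_cons; apply: measurableI => //; case: b; first exact: mc.
rewrite (_ : [set _ | _] = ~` [set x | c x w]); first exact: measurableC.
by apply/seteqP; split => x /=; [move=> -> | move=> /negP/negbTE].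
Qed.

End measurable_itineraries.

(** * Integrals and functions with finitely many values *)

Section finite_valued_functions.
Local Open Scope classical_set_scope.
Local Open Scope ring_scope.
Context d {T : measurableType d} {R : realType} (P : probability T R).
Context {W : finType} (c : T -> W).
Hypothesis mc : forall w, measurable (c @^-1` [set w]).

Lemma measurable_preimage_fin (A : set W) : measurable (c @^-1` A).
Proof.
rewrite (_ : _ @^-1` _ = \bigcup_(w in A) c @^-1` [set w]).
  by apply: fin_bigcup_measurable => // ; exact: sub_finite_set (finite_finset _).
by apply/seteqP; split => [x Ax|x [w Aw /= ->]//]; exists (c x).
Qed.

Lemma integrable_bounded (f : T -> R) (M : R) : measurable_fun setT f ->
  (forall x, `|f x| <= M) -> P.-integrable setT (EFin \o f).
Proof.
move=> mf fM; apply: measurable_bounded_integrable => //.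
  by rewrite (le_lt_trans (probability_le1 _ _))// ltry.
exists M; split; first exact: num_real.
by move=> r /ltW Mr x _; exact: le_trans (fM x) Mr.
Qed.

Lemma measurable_fin_comp (h : W -> R) : measurable_fun setT (h \o c).
Proof.
by move=> _ Y _; rewrite setTI comp_preimage; exact: measurable_preimage_fin.
Qed.

Lemma Rintegral_fin_comp (h : W -> R) :
  \int[P]_x h (c x) = \sum_w h w * fine (P (c @^-1` [set w])).
Proof.
rewrite /Rintegral.
transitivity (fine (\int[P]_x (\sum_w (h w)%:E * (\1_(c @^-1` [set w]) x)%:E)%E)).
  congr fine; apply: eq_integral => x _.
  rewrite (bigD1 (c x))//= big1 ?addr0; last first.
    by move=> w wx; rewrite indicE memNset ?mule0// => /= xw; rewrite xw eqxx in wx.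
  by rewrite indicE mem_set// mule1.
have mi w : P.-integrable setT (fun x => (\1_(c @^-1` [set w]) x)%:E).
  exact: integrable_indic.
rewrite integral_sum//; last by move=> w; exact: integrableZl.
rewrite -sum_fine; last first.
  move=> w _; rewrite integralZl// integral_indic// setIT.
  by rewrite fin_numM// fin_num_measure.
apply: eq_bigr => w _; rewrite integralZl// integral_indic// setIT fineM//.
exact: fin_num_measure.
Qed.

Lemma probability_preimage_fin (A : set W) :
  fine (P (c @^-1` A)) = \sum_(w | w \in A) fine (P (c @^-1` [set w])).
Proof.
have := Rintegral_fin_comp (\1_A); rewrite /Rintegral.
have -> : (fun x => (\1_A (c x))%:E) = (fun x => (\1_(c @^-1` A) x)%:E :> \bar R).
  by [].
rewrite integral_indic// ?setIT; last exact: measurable_preimage_fin.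
move=> ->; rewrite [RHS]big_mkcond; apply: eq_bigr => w _.
by rewrite indicE; case: ifP; rewrite ?mul1r ?mul0r.
Qed.

(** Where [f] is not controlled by [h \o c], it still differs from it by at most
[2 M], and this happens with probability at most [delta]. *)
Lemma Rintegral_approx_fin (f : T -> R) (h : W -> R) (M e delta : R) (A : set T) :
    measurable_fun setT f -> (forall x, `|f x| <= M) -> (forall w, `|h w| <= M) ->
    measurable A -> 0 <= e -> 0 <= M -> ((1 - delta)%:E <= P A)%E ->
    (forall x, A x -> `|f x - h (c x)| <= e) ->
  `|\int[P]_x f x - \sum_w h w * fine (P (c @^-1` [set w]))| <=
    e + (M *+ 2) * delta.
Proof.
move=> mf fM hM mA e0 M0 PA fh.
rewrite -Rintegral_fin_comp.
have intf := integrable_bounded mf fM.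
have inth : P.-integrable setT (EFin \o (h \o c)).
  by apply: integrable_bounded => [|x]; [exact: measurable_fin_comp|exact: hM].
rewrite -RintegralB//.
have intfh : P.-integrable setT (EFin \o (fun x => f x - h (c x))).
  exact: (integrableB measurableT intf inth).
apply: le_trans (le_normr_Rintegral _ intfh) _ => //.
have intA : P.-integrable setT (EFin \o (\1_(~` A) : T -> R)).
  by apply: integrable_indic; exact: measurableC.
have intM := finite_measure_integrable_cst P e measurableT.
have intg : P.-integrable setT (EFin \o (fun x => e + (M *+ 2) * \1_(~` A) x)).
  exact: (integrableD measurableT intM (integrableZl measurableT _ intA)).
apply: (@le_trans _ _ (\int[P]_x (e + (M *+ 2) * \1_(~` A) x))).
  apply: le_Rintegral => //.
    exact: integrable_norm.
  move=> x _; rewrite indicE; have [Ax|nAx] := pselect (A x).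
    rewrite memNset ?mulr0 ?addr0; last by move=> /(_ Ax).
    exact: fh.
  rewrite mem_set// mulr1 (le_trans (ler_normB _ _))//.
  by rewrite mulr2n ler_wpDl// lerD.
rewrite RintegralD//; last exact: (integrableZl measurableT _ intA).
rewrite Rintegral_cst// RintegralZl// [X in fine X](probability_setT P) mulr1 lerD2l.
apply: ler_wpM2l; first by rewrite mulrn_wge0.
rewrite /Rintegral integral_indic//; last exact: measurableC.
rewrite setIT [X in fine X](probability_setC P mA).
have Pfin : P A \is a fin_num by exact: fin_num_measure.
rewrite -lee_fin fineK ?fin_numB// -(fineK Pfin) -EFinB lee_fin.
by move: PA; rewrite -(fineK Pfin) lee_fin; lra.
Qed.

End finite_valued_functions.

(** * Coding the unit interval by nested intervals of prescribed lengths *)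

Section interval_code.
Local Open Scope classical_set_scope.
Local Open Scope ring_scope.
Context {R : realType} (p : seq bool -> R).
Hypothesis p_nil : p [::] = 1.
Hypothesis p_ge0 : forall w, 0 <= p w.
Hypothesis p_split : forall w, p w = p (false :: w) + p (true :: w).

(** The interval of [w] is cut into that of [false :: w], on the left, and that of
[true :: w]. *)
Fixpoint left_end w : R :=
  if w is b :: w' then left_end w' + (if b then p (false :: w') else 0) else 0.

Definition interval_code (x : R) w := left_end w + p (false :: w) <= x.

Lemma cell_interval_code w :
  cell interval_code w `&` `[0, 1[%classic = `[left_end w, left_end w + p w[%classic.
Proof.
elim: w => [|b w IHw]; first by rewrite cell_nil setTI/= p_nil add0r.
rewrite cell_cons setIAC IHw; apply/seteqP.
have := p_ge0 (false :: w); have := p_ge0 (true :: w); have := p_split w.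
case: b => /= pw pt pf; split => x; rewrite /interval_code/= !in_itv/=.
- by move=> [/andP[? ?] ?]; apply/andP; split => //; lra.
- by move=> /andP[? ?]; split => //; apply/andP; split; lra.
- by move=> [/andP[? ?] /negbT]; rewrite -ltNge => ?; apply/andP; split; lra.
- move=> /andP[? ?]; split; first by apply/andP; split; lra.
  by apply/negbTE; rewrite -ltNge; lra.
Qed.

(** The half-open interval of the word of [x] contains [x], so it is nonempty. *)
Lemma itinerary_interval_code_gt0 n x : 0 <= x < 1 ->
  0 < p (itinerary interval_code n x).
Proof.
move=> x01.
have : (cell interval_code (itinerary interval_code n x) `&` `[0, 1[%classic) x.
  by split; [exact: itinerary_cell|rewrite /= in_itv].
by rewrite cell_interval_code/= in_itv/=; lra.
Qed.

Lemma measurable_interval_code w : measurable [set x : R | interval_code x w].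
Proof.
rewrite (_ : [set _ | _] = `[left_end w + p (false :: w), +oo[%classic) //.
by apply/seteqP; split => x; rewrite /interval_code/= in_itv/= andbT.
Qed.

Lemma uniform_prob_sub (U : set R) : measurable U -> U `<=` `[0, 1] ->
  uniform_prob (@ltr01 R) U = lebesgue_measure U.
Proof.
move=> mU U01; rewrite /uniform_prob (eq_integral (cst 1%E)); last first.
  move=> x /set_mem/U01; rewrite /= in_itv/= /uniform_pdf => ->.
  by rewrite subr0 invr1.
by rewrite integral_cst// mul1e.
Qed.

Lemma uniform_prob_itvco (a b : R) : 0 <= a -> a <= b -> b <= 1 ->
  uniform_prob (@ltr01 R) `[a, b[%classic = (b - a)%:E.
Proof.
move=> a0 ab b1; rewrite uniform_prob_sub//.
  rewrite lebesgue_measure_itv/= lte_fin; case: ltP => // ba.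
  by have -> : a = b by [lra]; rewrite subrr.
by move=> x /=; rewrite !in_itv/=; lra.
Qed.

Lemma left_end_bounds w : 0 <= left_end w /\ left_end w + p w <= 1.
Proof.
elim: w => [|b w [IHl IHr]]; first by rewrite /= p_nil; lra.
have := p_ge0 (false :: w); have := p_ge0 (true :: w); have := p_split w.
by case: b => /=; lra.
Qed.

Definition uniform01 : probability (measurableTypeR R) R :=
  uniform_prob (@ltr01 R).

Lemma uniform01_unit : uniform01 `[0, 1[%classic = 1%E.
Proof. by rewrite [LHS]uniform_prob_itvco ?subr0. Qed.

Lemma uniform01_setI (A : set (measurableTypeR R)) : measurable A ->
  uniform01 (A `&` `[0, 1[) = uniform01 A.
Proof.
move=> mA; rewrite [RHS](measureDI _ mA (measurable_itv `[0, 1[)).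
rewrite [X in (X + _)%E](_ : _ = 0%E) ?add0e//.
apply/eqP; rewrite -measure_le0; apply: (@le_trans _ _ (uniform01 (~` `[0, 1[))).
  apply: le_measure; rewrite ?inE; last exact: subDsetr.
  - exact: measurableD.
  - exact: measurableC.
by rewrite probability_setC// uniform01_unit subee.
Qed.

Lemma uniform01_cell w : uniform01 (cell interval_code w) = (p w)%:E.
Proof.
rewrite -uniform01_setI; last first.
  by apply: measurable_cell => v; exact: measurable_interval_code.
rewrite cell_interval_code.
have [l0 r1] := left_end_bounds w; have pw := p_ge0 w.
by rewrite [LHS]uniform_prob_itvco ?lerDl// addrAC subrr add0r.
Qed.

End interval_code.

(** * Small cells in compact sets *)

Section small_cells.
Local Open Scope classical_set_scope.
Local Open Scope ring_scope.
Context {R : realType} {S : pmetricType R}.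

Lemma separable_basis : separable S -> exists B : nat -> set S,
  (forall n, open (B n)) /\
  forall x U, nbhs x U -> exists n, B n x /\ B n `<=` U.
Proof.
move=> [D /pcard_surjP[s sD] denseD].
pose B n : set S := let ik := odflt (0, 0)%N (unpickle n : option (nat * nat)) in
  (ball (s ik.1) ik.2.+1%:R^-1)°.
exists B; split => [n|x U /nbhs_ballP[e /= e0 xeU]]; first exact: open_interior.
have [k ke] : exists k : nat, (k.+1%:R^-1 : R) < e / 2.
  have e20 : 0 < e / 2 by rewrite divr_gt0.
  have [k _ /(_ k (leqnn k))] := near_infty_natSinv_lt (PosNum e20).
  by exists k.
have ke2 : (k.+1%:R^-1 : R) / 2 <= e / 2.
  have : 0 < (k.+1%:R^-1 : R) by rewrite invr_gt0.
  by move: ke; move: (k.+1%:R^-1) => r ke r0; lra.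
have r0 : 0 < (k.+1%:R^-1 : R) / 2 by rewrite divr_gt0// invr_gt0.
have [y [xy Dy]] := denseD (ball x (k.+1%:R^-1 / 2))°
  (ex_intro _ x (nbhsx_ballx x _ r0)) (open_interior _).
have [i _ iy] := sD _ Dy.
exists (pickle (i, k)); rewrite /B pickleK/= iy; split.
  apply: filterS (nbhsx_ballx x _ r0) => z xz.
  by apply: ball_split xz; apply: ball_sym; exact: interior_subset xy.
move=> z /interior_subset yz; apply: xeU; rewrite (splitr e).
apply: (@ball_triangle _ _ y).
  exact: le_ball (interior_subset xy).
by apply: le_ball yz; exact: ltW.
Qed.

(** Only part of the sets [B n] form a base: the other ones will be compact. *)
Variable B : nat -> set S.
Hypothesis basisB : forall x U, nbhs x U ->
  exists n, [/\ open (B n), B n x & B n `<=` U].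

(** Finitely many basic sets that satisfy [Q] cover [K]; once a word is long enough
to decide membership in all of them, a point of its cell lies in one of them, and
then so does the whole cell. *)
Lemma compact_small_cells (K : set S) (Q : set S -> Prop) : compact K ->
    (forall U V, V `<=` U -> Q U -> Q V) ->
    (forall x, K x -> exists2 U, nbhs x U & Q U) ->
  exists N, forall w, (N <= size w)%N ->
    cell (membership_code B) w !=set0 -> cell (membership_code B) w `<=` K ->
    Q (cell (membership_code B) w).
Proof.
rewrite compact_cover => cK Qsub Qloc.
have [|x Kx|F FD KF] := cK nat [set n | open (B n) /\ Q (B n)] B.
- by move=> n [].
- have [U xU QU] := Qloc x Kx; have [n [oB Bx BU]] := basisB xU.
  by exists n => //; split => //; exact: Qsub QU.
exists (\max_(n <- finmap.enum_fset F) n).+1%N => w Nw [x wx] wK.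
have [n /= nF Bnx] := KF x (wK _ wx).
have [_ QB] := set_mem (FD _ nF).
apply: Qsub QB; apply: cell_membership_sub wx Bnx.
by apply: leq_trans Nw; rewrite ltnS; exact: leq_bigmax_seq.
Qed.

(** The points have a cluster point [l] in [K]. For closed neighbourhoods of [l]
inside a given one, small cells either lie in the large neighbourhood or miss the
small one; the latter contradicts clustering at [l]. *)
Lemma cvg_of_decreasing_cells (K : set S) (w : nat -> seq bool) (y : nat -> S) n0 :
    compact K -> (forall n, size (w n) = n) ->
    (forall m n, (m <= n)%N -> cell (membership_code B) (w m) (y n)) ->
    cell (membership_code B) (w n0) `<=` K ->
    (forall m n, (m <= n)%N ->
      cell (membership_code B) (w n) `<=` cell (membership_code B) (w m)) ->
  cvg (y n @[n --> \oo]).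
Proof.
move=> cK sw yw wK w_homo.
have yK : \forall n \near \oo, K (y n).
  by exists n0 => // n /= n0n; apply: wK; exact: yw.
have [l [Kl cl]] := cK (y n @[n --> \oo]) _ yK.
apply/cvg_ex; exists l => U lU.
have [V lV VU] : filter_from (nbhs l) closure U°.
  by apply: uniform_regular; exact: nbhs_interior.
pose Q C := C `<=` U \/ C `<=` ~` V.
have [|x Kx|N smallN] := @compact_small_cells K Q cK.
- by move=> C C' CC' [CU|CV]; [left|right]; exact: subset_trans CC' _.
- have [Vx|nVx] := pselect (closure V x).
    by exists U; [exact: VU|left].
  exists (~` closure V).
    exact: open_nbhs_nbhs (conj (closed_openC (@closed_closure _ V)) nVx).
  by right; apply: subsetC; exact: subset_closure.
have n1K : cell (membership_code B) (w (maxn N n0)) `<=` K.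
  by apply: subset_trans wK; apply: w_homo; exact: leq_maxr.
have [||CU|CV] := smallN (w (maxn N n0)) _ _ n1K.
- by rewrite sw leq_maxl.
- by exists (y (maxn N n0)); exact: yw.
- by exists (maxn N n0) => // n /= n1n; apply: CU; exact: yw.
- have yV : \forall n \near \oo, (~` V) (y n).
    by exists (maxn N n0) => // n /= n1n; apply: CV; exact: yw.
  by have [z []] := cl (~` V) V yV lV.
Qed.

End small_cells.

(** * Borel measurability *)

Section borel_measurability.
Local Open Scope classical_set_scope.
Local Open Scope ring_scope.
Context {R : realType} {S : pmetricType R}.

Lemma borel_open (U : set S) : open U -> measurable (U : set (borel S)).
Proof. exact: sub_sigma_algebra. Qed.

Lemma borel_compact (K : set S) : compact K -> measurable (K : set (borel S)).
Proof.
move=> /(compact_closed (@metric_hausdorff R S))/closed_openC/borel_open.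
by move=> /measurableC; rewrite setCK.
Qed.

Lemma continuous_borel_measurable (f : S -> R) : continuous f ->
  measurable_fun setT (f : borel S -> R).
Proof.
move=> /continuousP cf; apply: (measurability _ (RGenOpens.measurableE R)).
move=> _ [_ [a [b ->] <-]]; rewrite setTI; apply: borel_open.
by apply: cf; exact: interval_open.
Qed.

(** For open [U], the limit is in [U] exactly if, for some [r > 0], the balls of
radius [r] around [Y n x] are in [U] for all large [n]. All preimages under [Y n]
are supposed measurable, as holds for a function with countably many values and
measurable fibers, so the sets [V k] need not be Borel. *)
Lemma borel_measurable_lim d (T : measurableType d) (E : set T)
    (Y : nat -> T -> S) (X : T -> S) : measurable E ->
    (forall n A, measurable (Y n @^-1` A)) ->
    (forall x, E x -> Y n x @[n --> \oo] --> X x) ->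
  measurable_fun E (X : T -> borel S).
Proof.
move=> mE mY YX; apply: (@measurability _ _ _ (borel S) _ _ (@open S)) => //.
move=> _ [U oU <-].
pose V k := [set y : S | ball y k.+1%:R^-1 `<=` U].
rewrite (_ : _ `&` _ =
    E `&` \bigcup_k \bigcup_m \bigcap_(n in [set n | (m <= n)%N]) Y n @^-1` V k).
  apply: measurableI => //; apply: bigcup_measurable => k _.
  apply: bigcup_measurable => m _.
  by apply: bigcap_measurable => //; exists m => /=.
apply/seteqP; split=> x [Ex] => [UXx|[k _ [m _ mV]]]; split => //.
  have /nbhs_ballP[e /= e0 eU] : nbhs (X x) U by exact: open_nbhs_nbhs.
  have e20 : 0 < e / 2 by rewrite divr_gt0.
  have [k _ /(_ k (leqnn k)) ke] := near_infty_natSinv_lt (PosNum e20).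
  have [m _ mX] : \forall n \near \oo, ball (X x) (e / 2) (Y n x).
    by have /cvg_ball := YX x Ex; apply.
  exists k => //; exists m => // n /= mn z Yz.
  apply: eU; rewrite (splitr e); apply: ball_triangle (mX n mn) _.
  by apply: le_ball Yz; exact: ltW.
have k0 : 0 < k.+1%:R^-1 :> R by rewrite invr_gt0.
have [m' _ mX] : \forall n \near \oo, ball (X x) k.+1%:R^-1 (Y n x).
  by have /cvg_ball := YX x Ex; apply.
apply: (mV (maxn m m')); first exact: leq_maxl.
by apply/ball_sym/mX => /=; exact: leq_maxr.
Qed.

End borel_measurability.

(** * The limit law *)

Section limit_measure.
Local Open Scope classical_set_scope.
Local Open Scope ring_scope.
Context {R : realType} {S : pmetricType R}.
Variables (B K : nat -> set S) (kappa : nat -> nat) (p : seq bool -> R).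
Hypothesis basisB : forall x U, nbhs x U ->
  exists n, [/\ open (B n), B n x & B n `<=` U].
Hypothesis compactK : forall j, compact (K j).
Hypothesis p_nil : p [::] = 1.
Hypothesis p_ge0 : forall w, 0 <= p w.
Hypothesis p_split : forall w, p w = p (false :: w) + p (true :: w).
Let cellB := cell (membership_code B).
Hypothesis p_cell : forall w, 0 < p w -> cellB w !=set0.
(** A word of length beyond [kappa j] will decide membership in [K j]. *)
Hypothesis p_tail : forall j n, (kappa j < n)%N ->
  1 - j.+1%:R^-1 <= \sum_(w : n.-tuple bool | `[< cellB w `<=` K j >]) p w.

Let word n x : seq bool := itinerary (interval_code p) n x.
Let P : probability (measurableTypeR R) R := uniform01.

Definition cell_point (w : seq bool) : S := xget point (cellB w).

Let sample n x := cell_point (word n x).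

(** The numbers whose word of length [n] already guarantees that the sample points
remain in [K j] from [n] on. *)
Definition captured j n : set R := [set x | cellB (word n x) `<=` K j].

Definition convergence_set : set R :=
  `[0, 1[ `&` \bigcup_j \bigcup_n captured j n.

Definition limit_point (x : R) : S :=
  if x \in convergence_set then lim (sample n x @[n --> \oo]) else point.

Let mfib n (w : n.-tuple bool) :
  measurable (itinerary_tuple (interval_code p) n @^-1` [set w]
    : set (measurableTypeR R)).
Proof.
rewrite preimage_itinerary_tuple; apply: measurable_cell => v.
exact: measurable_interval_code.
Qed.

Lemma measurable_word n (A : set (seq bool)) :
  measurable (word n @^-1` A : set (measurableTypeR R)).
Proof. exact: (measurable_preimage_fin (@mfib n) [set w | A (tval w)]). Qed.

Lemma measurable_convergence_set :
  measurable (convergence_set : set (measurableTypeR R)).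
Proof.
apply: measurableI; first exact: measurable_itv.
apply: bigcupT_measurable => j; apply: bigcupT_measurable => n.
exact: (measurable_word n [set w | cellB w `<=` K j]).
Qed.

Lemma cell_sample x m n : 0 <= x < 1 -> (m <= n)%N ->
  cellB (word m x) (sample n x).
Proof.
move=> x01 mn; apply: (cell_itinerary_sub mn); apply: xgetPex.
by apply: p_cell; exact: itinerary_interval_code_gt0.
Qed.

Lemma sample_cvg x : convergence_set x -> sample n x @[n --> \oo] --> limit_point x.
Proof.
move=> Cx; rewrite /limit_point mem_set//.
case: Cx; rewrite /= in_itv/= => x01 [j _ [n _ jn]].
suff : cvg (sample n x @[n --> \oo]) by [].
apply: (@cvg_of_decreasing_cells _ _ B basisB (K j) (fun n => word n x) _ n).
- exact: compactK.
- by move=> m; exact: size_itinerary.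
- by move=> m k; exact: cell_sample.
- exact: jn.
- by move=> m k; exact: cell_itinerary_sub.
Qed.

Lemma measurable_limit_point :
  measurable_fun setT (limit_point : measurableTypeR R -> borel S).
Proof.
have mC := measurable_convergence_set.
rewrite -(setUv convergence_set); apply/measurable_funU => //.
  exact: measurableC.
split.
  apply: (borel_measurable_lim mC (Y := sample)) sample_cvg => n A.
  exact: (measurable_word n (cell_point @^-1` A)).
apply: (@eq_measurable_fun _ _ _ (borel S) _ (cst (point : borel S))).
  by move=> x /set_mem Cx; rewrite /limit_point memNset.
exact: measurable_cst.
Qed.

(** As [j] grows, this shows that the set of convergence has full measure. *)
Lemma uniform01_captured j n : (kappa j < n)%N ->
  ((1 - j.+1%:R^-1)%:E <= P (captured j n `&` `[0%R, 1%R[))%E.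
Proof.
move=> jn; rewrite [P _]uniform01_setI; last first.
  exact: (measurable_word n [set w | cellB w `<=` K j]).
rewrite -[X in (_ <= X)%E]fineK ?fin_num_measure//; last first.
  exact: (measurable_word n [set w | cellB w `<=` K j]).
rewrite lee_fin; apply: le_trans (p_tail jn) _.
have := probability_preimage_fin P (@mfib n) [set w | cellB (tval w) `<=` K j].
rewrite [X in fine (P X)](_ : _ = captured j n)// => ->.
rewrite le_eqVlt; apply/orP; left; apply/eqP; apply: eq_big => [w|w _].
  by apply/asboolP/idP => [|/set_mem//]; exact: mem_set.
by rewrite preimage_itinerary_tuple [X in fine X]uniform01_cell.
Qed.

(** The limit point of [x] is a limit of points of the cell of the [n]-th word of
[x], so that [f] at this limit is within [e] of its value at the chosen point of
that cell, although the limit itself may lie outside the cell. *)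
Lemma limit_measure_exists : exists nu : probability (borel S) R,
  forall (f : S -> R) (M e : R) j n, continuous f -> 0 <= M -> 0 <= e ->
    (forall x, `|f x| <= M) -> (kappa j < n)%N ->
    (forall (w : n.-tuple bool) y z, cellB w `<=` K j -> cellB w y -> cellB w z ->
      `|f y - f z| <= e) ->
  `|\int[nu]_x f x - \sum_(w : n.-tuple bool) f (cell_point w) * p w| <=
    e + (M *+ 2) * j.+1%:R^-1.
Proof.
pose X : {mfun (measurableTypeR R) >-> (borel S)} :=
  mfun_Sub (mem_set measurable_limit_point).
exists (distribution P X) => f M e j n cf M0 e0 fM jn osc.
have mf := continuous_borel_measurable cf.
have mfX : measurable_fun setT (f \o limit_point : measurableTypeR R -> R).
  exact: measurableT_comp mf measurable_limit_point.
have -> : \int[distribution P X]_x f x = \int[P]_x f (limit_point x).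
  rewrite /Rintegral integral_distribution//; first exact/measurable_EFinP.
  by apply: (@integrable_bounded _ _ _ P (f \o limit_point) M) => // x; exact: fM.
have := @Rintegral_approx_fin _ _ _ P _ _ (@mfib n) (f \o limit_point)
  (fun w => f (cell_point w)) M e j.+1%:R^-1 (captured j n `&` `[0, 1[).
under [X in `|_ - X|]eq_bigr => w _ do
  rewrite preimage_itinerary_tuple [X in fine X]uniform01_cell//=.
apply=> //.
- by move=> x; exact: fM.
- apply: measurableI => //.
  exact: (measurable_word n [set w | cellB w `<=` K j]).
- exact: uniform01_captured.
move=> x [jx]; rewrite /= in_itv/= => x01.
have Cx : convergence_set x.
  by split; [rewrite /= in_itv|exists j => //; exists n].
have fX : f (sample m x) @[m --> \oo] --> f (limit_point x).
  by apply: (cvg_comp _ _ (sample_cvg Cx)); exact: cf.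
have nX : `|f (sample m x) - f (cell_point (word n x))| @[m --> \oo] -->
    `|f (limit_point x) - f (cell_point (word n x))|.
  by apply: cvg_norm; apply: cvgB fX _; exact: cvg_cst.
apply: (cvgr_to_le nX).
exists n => // m /= nm; apply: (osc (itinerary_tuple (interval_code p) n x)) => //.
- exact: cell_sample.
- exact: (@cell_sample x n n).
Qed.

End limit_measure.

(** * Weak convergence *)

Section cell_sums.
Local Open Scope classical_set_scope.
Local Open Scope ring_scope.
Context {R : realType} {S : pmetricType R}.
Variables (B K : nat -> set S) (kappa : nat -> nat).
Hypothesis compactK : forall j, compact (K j).
Hypothesis measurableB : forall n, measurable (B n : set (borel S)).
Hypothesis BK : forall j, B (kappa j) = K j.
Let code := membership_code B.

Lemma measurable_cell_membership w : measurable (cell code w : set (borel S)).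
Proof.
apply: measurable_cell => v; rewrite (_ : [set _ | _] = B (size v))//.
by apply/seteqP; split => x /=; rewrite /code/membership_code inE.
Qed.
Let mcell := measurable_cell_membership.

Let mfib n (w : n.-tuple bool) :
  measurable (itinerary_tuple code n @^-1` [set w] : set (borel S)).
Proof. by rewrite preimage_itinerary_tuple. Qed.

Lemma cell_itinerary_sub_compact j n x : (kappa j < n)%N -> K j x ->
  cell code (itinerary code n x) `<=` K j.
Proof.
rewrite -BK => jn; apply: cell_membership_sub; first by rewrite size_itinerary.
exact: itinerary_cell.
Qed.

Variable nu : probability (borel S) R.

Lemma probability_cell_split w : fine (nu (cell code w)) =
  fine (nu (cell code (false :: w))) + fine (nu (cell code (true :: w))).
Proof.
rewrite -fineD ?fin_num_measure//; congr fine.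
rewrite -measureU//; last first.
  by rewrite !cell_cons; apply/seteqP; split => x //= [[_ ->] []].
rewrite !cell_cons -setIUr; congr (nu _); apply/seteqP; split => x [] // wx.
by split => //=; case: code; [right|left].
Qed.

Lemma le_probability_compact_cells j n : (kappa j < n)%N ->
  fine (nu (K j)) <=
  \sum_(w : n.-tuple bool | `[< cell code w `<=` K j >]) fine (nu (cell code w)).
Proof.
move=> jn.
have mA := measurable_preimage_fin (@mfib n) [set w | cell code (tval w) `<=` K j].
rewrite [leRHS](_ : _ = fine (nu (itinerary_tuple code n @^-1`
    [set w | cell code (tval w) `<=` K j]))); last first.
  rewrite (probability_preimage_fin nu (@mfib n)); apply: eq_big => [w|w _].
    by apply/asboolP/idP => [|/set_mem//]; exact: mem_set.
  by rewrite preimage_itinerary_tuple.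
apply: fine_le; rewrite ?fin_num_measure//; first exact: borel_compact.
apply: le_measure; rewrite ?inE//; first exact: borel_compact.
by move=> x Kx; exact: cell_itinerary_sub_compact.
Qed.

(** The same finite sum as in [limit_measure_exists], with the same error bound. *)
Lemma Rintegral_approx_cells (f : S -> R) (g : seq bool -> S) (M e : R) j n :
    continuous f -> 0 <= M -> 0 <= e -> (forall x, `|f x| <= M) ->
    ((1 - j.+1%:R^-1)%:E <= nu (K j))%E -> (kappa j < n)%N ->
    (forall w, cell code w !=set0 -> cell code w (g w)) ->
    (forall (w : n.-tuple bool) y z, cell code w `<=` K j ->
      cell code w y -> cell code w z -> `|f y - f z| <= e) ->
  `|\int[nu]_x f x - \sum_(w : n.-tuple bool) f (g w) * fine (nu (cell code w))| <=
    e + (M *+ 2) * j.+1%:R^-1.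
Proof.
move=> cf M0 e0 fM Kj jn gP osc.
have := @Rintegral_approx_fin _ _ _ nu _ _ (@mfib n) f (fun w => f (g w))
  M e j.+1%:R^-1 (K j).
under [X in `|_ - X|]eq_bigr => w _ do rewrite preimage_itinerary_tuple.
apply => //.
- exact: continuous_borel_measurable.
- exact: borel_compact.
move=> x Kx; apply: (osc (itinerary_tuple code n x)) => //=.
- exact: cell_itinerary_sub_compact.
- exact: itinerary_cell.
- by apply: gP; exists x; exact: itinerary_cell.
Qed.

End cell_sums.

Section weak_limit.
Local Open Scope classical_set_scope.
Local Open Scope ring_scope.
Context {R : realType} {S : pmetricType R}.
Variables (B K : nat -> set S) (kappa : nat -> nat).
Hypothesis basisB : forall x U, nbhs x U ->
  exists n, [/\ open (B n), B n x & B n `<=` U].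
Hypothesis compactK : forall j, compact (K j).
Hypothesis measurableB : forall n, measurable (B n : set (borel S)).
Hypothesis BK : forall j, B (kappa j) = K j.
Let code := membership_code B.

Variables (nu_ : nat -> probability (borel S) R) (p : seq bool -> R).
Hypothesis tightK : forall j k, ((1 - j.+1%:R^-1)%:E <= nu_ k (K j))%E.
Hypothesis cvg_p :
  forall w, fine (nu_ k (cell code w)) @[k --> \oo] --> p w.

Let p_nil : p [::] = 1.
Proof.
apply: cvg_unique (@cvg_p [::]) _ => //.
rewrite (_ : (fun k => _) = cst 1); first exact: cvg_cst.
by apply/funext => k; rewrite cell_nil [X in fine X](probability_setT (nu_ k)).
Qed.

Let p_ge0 w : 0 <= p w.
Proof. by apply: (cvgr_to_ge (@cvg_p w)); apply: nearW => k; exact: fine_ge0. Qed.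

Let p_split w : p w = p (false :: w) + p (true :: w).
Proof.
apply: cvg_unique (@cvg_p w) _ => //.
rewrite (_ : (fun k => _) = fun k => fine (nu_ k (cell code (false :: w))) +
    fine (nu_ k (cell code (true :: w)))).
  by apply: cvgD; exact: cvg_p.
by apply/funext => k; exact: probability_cell_split.
Qed.

Let p_cell w : 0 < p w -> cell code w !=set0.
Proof.
move=> pw; apply/set0P/eqP => w0; move: pw.
have -> : p w = 0; last by rewrite ltxx.
apply: cvg_unique (@cvg_p w) _ => //.
rewrite (_ : (fun k => _) = cst 0); first exact: cvg_cst.
by apply/funext => k; rewrite w0 measure0.
Qed.

Let p_tail j n : (kappa j < n)%N -> 1 - j.+1%:R^-1 <=
  \sum_(w : n.-tuple bool | `[< cell code w `<=` K j >]) p w.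
Proof.
move=> jn; pose good (w : n.-tuple bool) := `[< cell code w `<=` K j >].
have cvg_sum : \sum_(w | good w) fine (nu_ k (cell code w)) @[k --> \oo] -->
    \sum_(w | good w) p w.
  by apply: cvg_big => [|w _]; [exact: add_continuous|exact: cvg_p].
apply: (cvgr_to_ge cvg_sum); apply: nearW => k.
apply: le_trans (le_probability_compact_cells compactK measurableB BK _ jn).
rewrite -lee_fin fineK; first exact: tightK.
by apply: fin_num_measure; exact: borel_compact.
Qed.

(** Convergence of the mass of every cell, together with uniform tightness, implies
weak convergence, although the limits [p w] need not be the masses of the cells
under the limit measure. *)
Lemma weak_cvg_cell_masses :
  exists nu : probability (borel S) R, weak_cvg nu_ nu.
Proof.
have [nu nuP] :=
  limit_measure_exists basisB compactK p_nil p_ge0 p_split p_cell p_tail.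
exists nu => f cf [M0 [_ M0P]].
pose M : R := `|M0| + 1.
have fM x : `|f x| <= M by apply: M0P => //; rewrite /M ltr_pwDr// ler_norm.
have M_ge0 : 0 <= M by rewrite addr_ge0.
have integralE (P : probability (borel S) R) :
    (\int[P]_x (f x)%:E)%E = (\int[P]_x f x)%:E.
  rewrite fineK//; apply: integrable_fin_num => //.
  exact: integrable_bounded (continuous_borel_measurable cf) fM.
rewrite integralE; apply: cvg_EFin; first by apply: nearW => k; rewrite integralE.
under eq_fun do rewrite integralE.
apply/cvgrPdist_le => /= eps eps0.
(* Each of the two integrals is within eps/8 + eps/8 of its finite sum, which
   leaves room for eps/4 between the two sums. *)
have e_gt0 : 0 < eps / 8 by lra.
have [j jM] : exists j : nat, M *+ 2 * j.+1%:R^-1 <= eps / 8.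
  have d_gt0 : 0 < eps / 8 / (M *+ 2 + 1).
    by rewrite divr_gt0// ltr_wpDl// mulrn_wge0.
  have [j _ /(_ j (leqnn j)) jd] := near_infty_natSinv_lt (PosNum d_gt0).
  exists j; apply: (@le_trans _ _ ((M *+ 2 + 1) * (eps / 8 / (M *+ 2 + 1)))).
    by apply: ler_pM; rewrite ?mulrn_wge0// ?lerDl// ltW.
  by rewrite mulrC divfK// gt_eqF// ltr_wpDl// mulrn_wge0.
have [|x Kx|N smallN] := @compact_small_cells _ _ B basisB (K j)
    (fun U => forall y z, U y -> U z -> `|f y - f z| <= eps / 8) (@compactK j).
- by move=> U V VU Uosc y z Vy Vz; apply: Uosc; exact: VU.
- have e2 : 0 < eps / 8 / 2 by lra.
  have /cvgrPdist_le/(_ _ e2) xU := cf x.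
  exists [set y | `|f x - f y| <= eps / 8 / 2] => // y z xy xz.
  by rewrite (le_trans (ler_distD (f x) _ _))// distrC (splitr (eps / 8)) lerD.
pose n := maxn N (kappa j).+1.
have jn : (kappa j < n)%N by rewrite leq_max leqnn orbT.
have osc (w : n.-tuple bool) y z : cell code w `<=` K j -> cell code w y ->
    cell code w z -> `|f y - f z| <= eps / 8.
  move=> wK wy wz; apply: (smallN w) => //; last by exists y.
  by rewrite size_tuple leq_maxl.
have nu_sum := nuP f M _ j n cf M_ge0 (ltW e_gt0) fM jn osc.
have pointP w : cell code w !=set0 -> cell code w (cell_point B w).
  exact: xgetPex.
have nu_k_sum k := Rintegral_approx_cells compactK measurableB BK cf M_ge0
  (ltW e_gt0) fM (tightK j k) jn pointP osc.
have cvg_sums :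
    \sum_(w : n.-tuple bool) f (cell_point B w) * fine (nu_ k (cell code w))
      @[k --> \oo] --> \sum_(w : n.-tuple bool) f (cell_point B w) * p w.
  apply: cvg_big => [|w _]; first exact: add_continuous.
  by apply: cvgM (@cvg_p w); exact: cvg_cst.
have e4 : 0 < eps / 4 by lra.
have /cvgrPdist_le/(_ _ e4) := cvg_sums; apply: filterS => k.
move: nu_sum (nu_k_sum k) jM; rewrite -/code !ler_distlC.
(* Linear arithmetic in these five numbers remains. *)
move: (\int[nu]_x f x) (\int[nu_ k]_x f x) (M *+ 2 / j.+1%:R) => a b d.
move: (\sum_(w : n.-tuple bool) f (cell_point B w) * p w) => sum_p.
move: (\sum_(w : n.-tuple bool) _) => sum_k.
lra.
Qed.

End weak_limit.

Theorem theorem2 (R : realType) (S : pmetricType R)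
    (mu : nat -> probability (borel S) R) :
  separable S -> tight mu ->
  exists (phi : nat -> nat) (nu : probability (borel S) R),
    (forall i j : nat, (i < j)%N -> (phi i < phi j)%N) /\
    weak_cvg (fun k => mu (phi k)) nu.
Proof.
move=> /separable_basis[B0 [oB0 B0P]] tmu.
have tight_seq (j : nat) : exists K : set S, compact K /\
    forall n, ((1 - j.+1%:R^-1)%:E <= mu n K)%E.
  by have [|K cK muK] := tmu j.+1%:R^-1%R; [rewrite invr_gt0|exists K].
have [K KP] := choice tight_seq.
have cK j := (KP j).1.
(* Even indices run through the base, odd ones through the compact sets. *)
pose B n := if odd n then K n./2 else B0 n./2.
pose kappa j := j.*2.+1.
have BK j : B (kappa j) = K j by rewrite /B/kappa /= odd_double/= uphalf_double.
have basisB (x : S) U : nbhs x U ->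
    exists n, [/\ open (B n), B n x & (B n `<=` U)%classic].
  by move=> /B0P[n [B0x B0U]]; exists n.*2; rewrite /B odd_double doubleK.
have mB n : measurable (B n : set (borel S)).
  by rewrite /B; case: ifP => _; [exact: borel_compact|exact: borel_open].
pose mass w n : R := fine (mu n (cell (membership_code B) w)).
have [|phi [p [phi_incr cvg_p]]] := @diagonal_extraction R (seq bool) mass.
  move=> w n; have mw := measurable_cell_membership mB w.
  by rewrite fine_ge0//= -lee_fin fineK ?fin_num_measure//; exact: probability_le1.
have [nu nuP] := weak_cvg_cell_masses basisB cK mB BK
  (fun j k => (KP j).2 (phi k)) cvg_p.
by exists phi, nu.
Qed.
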